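(* For the DRB game in the $k$-dimensional grid, the navigable small-world network ($\mathbf r\equiv k$) is a strong Nash equilibrium for sufficiently large $n$.
   Context: DRB (Distance-Reciprocity Balanced) game. Fix an integer $k\ge 1$ and $\gamma=1/g$ with $g\ge 2$ an integer. For an integer $n\ge 2$ let $V=\{1,\dots,n\}^k$, viewed as a torus grid with distance $d_M(u,v)=\sum_{i=1}^k\min\{|u_i-v_i|,\,n-|u_i-v_i|\}$. Each node $u\in V$ is a player with strategy $r_u\in\Sigma=\{0,\gamma,2\gamma,3\gamma,\dots\}$ and a constant exponent $\alpha_u>0$ (possibly different for different nodes). For $r\ge 0$ let $c(r)=\sum_{v\ne u}d_M(u,v)^{-r}$ (independent of $u$) and $p_u(v,r)=d_M(u,v)^{-r}/c(r)$ for $v\neq u$. The payoff of $u$ under the strategy profile $\mathbf r=(r_v)_{v\in V}$ is $$\pi_u(\mathbf r)=\pi_u(r_u,\mathbf r_{-u})=\Big(\sum_{v\ne u}p_u(v,r_u)\,d_M(u,v)\Big)^{\alpha_u}\Big(\sum_{v\ne u}p_u(v,r_u)\,p_v(u,r_v)\Big).$$ $\mathbf r\equiv s$ means $r_u=s$ for all $u\in V$. For $t\in\{1,\dots,|V|\}$, a profile $\mathbf r^*$ is a $t$-strong Nash equilibrium if for every nonempty $C\subseteq V$ with $|C|\le t$ there is no $\mathbf r_C\in\Sigma^C$ such that $\pi_u(\mathbf r_C,\mathbf r^*_{-C})\ge\pi_u(\mathbf r^* )$ for all $u\in C$ and $\pi_u(\mathbf r_C,\mathbf r^*_{-C})>\pi_u(\mathbf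 r^* )$ for some $u\in C$ (here $(\mathbf r_C,\mathbf r^*_{-C})$ is the profile where players in $C$ use $\mathbf r_C$ and the others use $\mathbf r^*$). A strong Nash equilibrium is a $|V|$-strong Nash equilibrium. A statement being true ''for sufficiently large $n$'' means that there exists a constant $n_0\in\mathbb N$, which may only depend on model constants such as $k$, $\gamma$ and $\alpha_u$, such that for all $n\ge n_0$ the statement is true in the grid with parameter $n$.
   Formalization: The constant exponents α_u are assumed to lie in a fixed range [a_min, a_max] with a_min > 0 independent of n, and n_0 depends only on k, γ and this range; with exponents unbounded across nodes (e.g. k=1, γ=1/2, α_u = u) the claim fails. *)

(* Defs.v *)
From HB Require Import structures.
From mathcomp Require Import all_boot all_order all_algebra.
From mathcomp Require Import reals exp.

Set Implicit Arguments.
Unset Strict Implicit.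
Unset Printing Implicit Defensive.

Import Order.TTheory GRing.Theory Num.Theory.
Local Open Scope ring_scope.

(* Coordinates range over {0, ..., n-1} instead of {1, ..., n}; only their
   differences matter below. *)
Definition node (k n : nat) := {ffun 'I_k -> 'I_n}.

Definition torus_dist (k n : nat) (u v : node k n) : nat :=
  (\sum_(i < k) minn `|u i - v i| (n - `|u i - v i|))%N.

Section Game.

Variables (R : realType) (k n : nat).
Notation V := (node k n).

Implicit Types (u v : V) (s : V -> R).

(* The value does not depend on [u], by translation invariance of the torus. *)
Definition norm_const u (r : R) : R :=
  \sum_(v | v != u) (torus_dist u v)%:R `^ (- r).

Definition link_prob u v (r : R) : R :=
  (torus_dist u v)%:R `^ (- r) / norm_const u r.

Definition mean_dist u (r : R) : R :=
  \sum_(v | v != u) link_prob u v r * (torus_dist u v)%:R.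

Definition reciprocity u s : R :=
  \sum_(v | v != u) link_prob u v (s u) * link_prob v u (s v).

Definition payoff (alpha : V -> R) u s : R :=
  (mean_dist u (s u)) `^ (alpha u) * reciprocity u s.

Definition is_strategy (gamma r : R) : Prop := exists m : nat, r = m%:R * gamma.

(* The profile (sC, s_{-C}); values of [sC] outside [C] are ignored. *)
Definition deviate (C : {set V}) (sC s : V -> R) : V -> R :=
  fun u => if u \in C then sC u else s u.

Definition t_strong_nash (gamma : R) (alpha : V -> R) (t : nat) s : Prop :=
  (forall u, is_strategy gamma (s u)) /\
  forall C : {set V}, C != set0 -> (#|C| <= t)%N ->
    ~ exists sC : V -> R,
        [/\ forall u, u \in C -> is_strategy gamma (sC u),
            forall u, u \in C ->
              payoff alpha u s <= payoff alpha u (deviate C sC s)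
          & exists2 u, u \in C &
              payoff alpha u s < payoff alpha u (deviate C sC s)].

Definition strong_nash (gamma : R) (alpha : V -> R) s : Prop :=
  t_strong_nash gamma alpha #|{: V}| s.

End Game.

(* Main.v *)
Require Import Defs.
From mathcomp Require Import all_boot all_order all_algebra.
From mathcomp Require Import reals exp.
From mathcomp Require Import zify ring lra.

Import Order.TTheory GRing.Theory Num.Theory.
Local Open Scope ring_scope.

(* Write c for the normalising constant of the exponent k; it is polylogarithmic
   in n, while the profile r = k pays at least (n / (B c))^alpha / c^2 with
   B = 2 k^k.  A deviator with exponent at least k + 1/g loses a factor of order
   n^(1/g) in its mean distance, and its reciprocity is at most 1 whatever the
   others do, so it is worse off.  Hence all members of a successful coalition
   use exponents in {0, 1/g, ..., k}.  The incoming link probabilities of any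
   node then sum to at most kg + 1, since for each fixed exponent they sum to 1;
   a deviator with exponent at most k - 1/g has outgoing link probabilities at
   most B / n^(1/g), so its reciprocity is O(n^(-1/g)), whereas its mean distance
   is at most kn.  It is worse off too, so nobody deviates. *)

Section CoalitionDeviations.

Set Implicit Arguments.
Unset Strict Implicit.
Unset Printing Implicit Defensive.

(** * The torus metric and its translation invariance *)

Definition cyclic_dist (n x : nat) : nat := minn x (n - x).

(** Taking differences modulo [n.+1] makes the metric a function of a group difference, hence
    translation invariant. *)
Lemma cyclic_dist_sub n (i j : 'I_n.+1) :
  minn `|i - j|%N (n.+1 - `|i - j|%N) = cyclic_dist n.+1 (i - j : 'I_n.+1)%R.
Proof.
have -> : (i - j : 'I_n.+1)%R = (if j <= i then i - j else i + n.+1 - j)%N :> nat.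
  have Hi := ltn_ord i; have Hj := ltn_ord j.
  rewrite /= modnDmr; case: ifP => ij.
    by rewrite (_ : (i + (n.+1 - j) = (i - j) + n.+1)%N) ?modnDr ?modn_small; lia.
  by rewrite modn_small; lia.
have Hi := ltn_ord i; have Hj := ltn_ord j.
by rewrite /cyclic_dist; case: ifP => ij; lia.
Qed.

Lemma torus_distE k n (u v : node k n.+1) :
  torus_dist u v = (\sum_(i < k) cyclic_dist n.+1 ((u - v)%R i : 'I_n.+1))%N.
Proof. by apply: eq_bigr => i _; rewrite cyclic_dist_sub !ffunE. Qed.

Lemma torus_dist_sym k n (u v : node k n) : torus_dist u v = torus_dist v u.
Proof. by apply: eq_bigr => i _; rewrite distnC. Qed.

Lemma torus_dist_gt0 k n (u v : node k n) : v != u -> (0 < torus_dist u v)%N.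
Proof.
have coord_eq (a b : nat) : minn `|a - b|%N (n - `|a - b|%N) == 0%N ->
  (a < n)%N -> (b < n)%N -> b = a by lia.
apply: contraNltn; rewrite leqn0 sum_nat_eq0 => /forallP /= d0.
by apply/eqP/ffunP => i; apply/ord_inj/(coord_eq _ _ (d0 i)).
Qed.

Lemma torus_dist_le k n (u v : node k n) : (torus_dist u v <= k * n)%N.
Proof.
apply: (@leq_trans (\sum_(i < k) n)); last by rewrite sum_nat_const card_ord.
apply: leq_sum => i _.
have Hi := ltn_ord (u i); have Hj := ltn_ord (v i); lia.
Qed.

(** A node at distance 1 contributes 1 to the normalising constant at every exponent; it also bounds
    reciprocity from below. *)
Lemma torus_neighbor k n (u : node k n) : (0 < k)%N -> (1 < n)%N ->
  exists2 v, v != u & torus_dist u v = 1.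
Proof.
case: k u => [|k] u // _; case: n u => [|[|n]] u // _.
have [y yu d1] : exists2 y : 'I_n.+2, y != u ord0 & `|u ord0 - y|%N = 1%N.
  have [u0|u0] := posnP (u ord0).
    by exists (inord 1); rewrite -?val_eqE /= u0 inordK.
  by exists (inord (u ord0).-1); rewrite -?val_eqE /= inordK; have := ltn_ord (u ord0); lia.
exists [ffun i => if i == ord0 then y else u i].
  by apply: contra_neq yu => /ffunP/(_ ord0); rewrite ffunE eqxx.
rewrite /torus_dist (bigD1 ord0) //= ffunE eqxx d1 big1 => [|i i0].
  by rewrite addn0; lia.
by rewrite ffunE (negbTE i0) distnn min0n.
Qed.

(** * Bounds on the normalising constant *)

Section NormConst.
Context {R : realType}.
Implicit Types (k n : nat) (r : R).

Lemma norm_const_eq k n (u v : node k n) r : norm_const u r = norm_const v r.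
Proof.
case: n u v => [|n] u v.
  by congr norm_const; apply/ffunP => i; case: (u i).
rewrite /norm_const (reindex_inj (addrI (u - v))) /=; apply: eq_big => [w|w _].
  by rewrite -subr_eq0 -[in RHS]subr_eq0 addrAC [u - v]addrC addrK addrC.
by rewrite !torus_distE opprD opprB addrA addrCA subrr addr0.
Qed.

Lemma powRD_gt0 (x r s : R) : 0 < x -> x `^ (r + s) = x `^ r * x `^ s.
Proof. by move=> x0; rewrite powRD // (gt_eqF x0) implybT. Qed.

Lemma norm_const_ge1 k n (u : node k n) r : (0 < k)%N -> (1 < n)%N ->
  1 <= norm_const u r.
Proof.
move=> k0 n1; have [v vu d1] := torus_neighbor u k0 n1.
rewrite /norm_const (bigD1 v) //= d1 powR1 lerDl.
by apply: sumr_ge0 => w _; exact: powR_ge0.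
Qed.

(** At least half of the n^k nodes differ from [u], all within distance kn; the factor k^(-r) is
    absorbed by k^k since r <= k. *)
Lemma norm_const_ge k n (u : node k n) r : (0 < k)%N -> (1 < n)%N ->
  0 <= r <= k%:R ->
  n%:R `^ (k%:R - r) <= 2 * k%:R `^ k%:R * norm_const u r.
Proof.
move=> k0 n1 /andP[r0 rk].
have kR : 0 < k%:R :> R by rewrite ltr0n.
have nR : 0 < n%:R :> R by rewrite ltr0n (ltn_trans _ n1).
have le_sum : (#|node k n|.-1)%:R * (k%:R * n%:R) `^ (- r) <= norm_const u r.
  have -> : (#|node k n|.-1)%:R * (k%:R * n%:R) `^ (- r)
      = \sum_(v | v != u) (k%:R * n%:R : R) `^ (- r).
    rewrite sumr_const -[RHS]mulr_natl; congr (_%:R * _).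
    by rewrite -(cardC1 u); apply: eq_card.
  apply: ler_sum => v vu; rewrite !powRN lef_pV2 ?posrE ?powR_gt0 ?mulr_gt0 //.
    apply: ge0_ler_powR; rewrite ?nnegrE ?mulr_ge0 ?ler0n //.
    by rewrite -natrM ler_nat torus_dist_le.
  by rewrite ltr0n torus_dist_gt0.
apply: le_trans (ler_wpM2l _ le_sum); last by rewrite mulr_ge0 ?powR_ge0.
rewrite card_ffun !card_ord powRM ?ler0n // powRD_gt0 //.
rewrite (powR_mulrn k (ltW nR)) -natrX.
have nk : (2 <= n ^ k)%N by rewrite (leq_trans n1) // -{1}(expn1 n) leq_pexp2l // ltnW.
have nkR : (n ^ k)%:R <= 2 * (n ^ k).-1%:R :> R.
  by rewrite -natrM ler_nat; lia.
have krk : 1 <= k%:R `^ k%:R * k%:R `^ (- r) :> R.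
  rewrite -powRD_gt0 // -[leLHS](powRr0 k%:R) ler_powR ?ler1n //.
  by rewrite subr_ge0.
have nr0 : 0 <= n%:R `^ (- r) by exact: powR_ge0.
have -> : 2 * k%:R `^ k%:R * ((n ^ k).-1%:R * (k%:R `^ (- r) * n%:R `^ (- r)))
  = 2 * (n ^ k).-1%:R * n%:R `^ (- r) * (k%:R `^ k%:R * k%:R `^ (- r)) by ring.
rewrite -[leLHS]mulr1 ler_pM // ?mulr_ge0 //.
exact: ler_wpM2r.
Qed.

(** By induction: ln(1 + x) <= x at x = -1/(n+2) gives 1/(n+2) <= ln(n+2) - ln(n+1). *)
Lemma harmonic_le n : (0 < n)%N ->
  \sum_(x < n) (x.+1)%:R^-1 <= 1 + ln n%:R :> R.
Proof.
elim: n => // -[|n] IH _; first by rewrite big_ord1 invr1 ln1 addr0.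
rewrite big_ord_recr /= (le_trans (lerD (IH _) (lexx _))) // -addrA lerD2l.
have n0 : 0 < n.+1%:R :> R by rewrite ltr0n.
have n1 : 0 < n.+2%:R :> R by rewrite ltr0n.
rewrite addrC -lerBrDr -lerN2 opprB -ln_div ?posrE //.
have -> : n.+1%:R / n.+2%:R = 1 + - n.+2%:R^-1 :> R.
  by rewrite -[n.+2]addn1 natrD; field; lra.
by apply: le_ln1Dx; rewrite ltrN2 invf_lt1 // ltr1n.
Qed.

(** The reciprocal of a minimum is at most the sum of the reciprocals, so two harmonic sums
    suffice. *)
Lemma sum_cyclic_dist_le n : (0 < n)%N ->
  \sum_(x < n) (maxn 1 (cyclic_dist n x))%:R^-1 <= 2 * (2 + ln n%:R) :> R.
Proof.
move=> n0; have Hn := harmonic_le n0.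
pose F (x : nat) : R := (maxn 1 x)%:R^-1.
have split_min (x : 'I_n) : (maxn 1 (cyclic_dist n x))%:R^-1 <= F x + F (n - x)%N.
  have F0 y : 0 <= F y by rewrite invr_ge0.
  rewrite /cyclic_dist; case: (leqP x (n - x)) => _.
    by rewrite /F lerDl F0.
  by rewrite /F lerDr F0.
apply: le_trans (ler_sum _ (fun x _ => split_min x)) _; rewrite big_split /=.
have -> : \sum_(i < n) F (n - i)%N = \sum_(x < n) x.+1%:R^-1.
  rewrite (reindex_inj rev_ord_inj) /=; apply: eq_bigr => i _.
  by rewrite /F; have Hi := ltn_ord i; congr (_%:R^-1); lia.
(* The index 0 counts as 1 because of [maxn], whence the extra summand. *)
have : \sum_(i < n) F i <= 1 + \sum_(x < n) x.+1%:R^-1.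
  case: n {Hn split_min} n0 => // n _.
  rewrite big_ord_recl big_ord_recr /= /F maxn0 invr1 lerD2l.
  rewrite -[leLHS]addr0 lerD ?invr_ge0 // le_eqVlt; apply/orP; left.
  by apply/eqP/eq_bigr => i _; rewrite /bump /= add1n; congr (_%:R^-1); lia.
lra.
Qed.

(* Since d >= max(1, d_i) for every coordinate distance d_i, the sum of d^-k is
   at most a product of k one-dimensional harmonic sums. *)
Lemma norm_const_dim_le k n (u : node k n) : (0 < n)%N ->
  norm_const u k%:R <= (2 * (2 + ln n%:R)) ^+ k :> R.
Proof.
case: n u => // n u n0.
pose G (x : 'I_n.+1) : R := (maxn 1 (cyclic_dist n.+1 x))%:R^-1.
have G0 x : 0 <= G x by rewrite invr_ge0.
have le_prod v : v != u ->
    (torus_dist u v)%:R `^ (- k%:R) <= \prod_(i < k) G (u i - v i).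
  move=> vu; have d0 := torus_dist_gt0 vu.
  have -> : (torus_dist u v)%:R `^ (- k%:R) = \prod_(i < k) (torus_dist u v)%:R^-1 :> R.
    by rewrite prodr_const card_ord powR_invn // exprVn.
  apply: ler_prod => i _; rewrite invr_ge0 ler0n /= lef_pV2 ?posrE ?ltr0n //.
    2: by rewrite leq_max.
  rewrite ler_nat geq_max d0 torus_distE (bigD1 i) //= !ffunE.
  exact: leq_addr.
rewrite /norm_const; apply: le_trans (ler_sum _ le_prod) _.
(* Adding the nonnegative term at [v = u] lets the sum run over all nodes and factor over the
   coordinates. *)
apply: (@le_trans _ _ (\sum_(v : node k n.+1) \prod_(i < k) G (u i - v i))).
  rewrite [leRHS](bigID (fun v => v != u)) /= lerDl.
  by apply: sumr_ge0 => v _; apply: prodr_ge0.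
rewrite -(bigA_distr_bigA (fun i x => G (u i - x))) /=.
have -> : (2 * (2 + ln n.+1%:R)) ^+ k = \prod_(i < k) (2 * (2 + ln n.+1%:R)) :> R.
  by rewrite prodr_const card_ord.
apply: ler_prod => i _; rewrite sumr_ge0 //=.
rewrite (reindex_inj (can_inj (subKr (u i)))) /=.
under eq_bigr do rewrite subKr.
exact: sum_cyclic_dist_le.
Qed.

(** Follows from e ln x = ln(x^e) < x^e, with 1 <= x^e absorbing the constant. *)
Lemma ln_le_powR (x e : R) : 1 <= x -> 0 < e ->
  2 * (2 + ln x) <= (4 + 2 / e) * x `^ e.
Proof.
move=> x1 e0; have x0 : 0 < x by lra.
have xe1 : 1 <= x `^ e by rewrite -(powRr0 x) ler_powR // ltW.
have : ln x <= x `^ e / e.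
  by rewrite ler_pdivlMr // mulrC -ln_powR ltW // ln_sublinear // powR_gt0.
have -> : (4 + 2 / e) * x `^ e = 4 * x `^ e + 2 * (x `^ e / e) by ring.
lra.
Qed.

Lemma norm_const_growth k (A p e : R) : (0 < k)%N -> 0 < p -> 0 < e ->
  exists n0 : nat, forall n : nat, (1 < n)%N -> (n0 <= n)%N ->
    forall u : node k n, A * norm_const u k%:R `^ p < n%:R `^ e.
Proof.
move=> k0 p0 e0.
(* With this [d], (n^d)^(kp) = n^(e/2), so the polylogarithmic bound uses up only half of the
   exponent [e]. *)
pose d : R := e / (2 * k%:R * p).
have kR : 0 < k%:R :> R by rewrite ltr0n.
have d0 : 0 < d by rewrite divr_gt0 // !mulr_gt0.
pose K : R := (4 + 2 / d) `^ (k%:R * p).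
(* Beyond [M], the remaining factor n^(e/2) exceeds the constant |A| K. *)
pose M : R := (`|A| * K + 1) `^ (2 / e).
exists (Num.truncn M).+1 => n n1 nM u.
have n1R : 1 <= n%:R :> R by rewrite ler1n ltnW.
have n0R : 0 < n%:R :> R by lra.
have d2 : 0 < 4 + 2 / d by rewrite addr_gt0 // divr_gt0.
have K0 : 0 < K by exact: powR_gt0.
have L0 : 0 <= 2 * (2 + ln n%:R) :> R by have := ln_ge0 n1R; lra.
have cK : norm_const u k%:R `^ p <= K * n%:R `^ (e / 2).
  have c0 : 0 <= norm_const u k%:R :> R.
    by apply: le_trans (norm_const_ge1 u k%:R k0 n1).
  have -> : K * n%:R `^ (e / 2) = (((4 + 2 / d) * n%:R `^ d) `^ k%:R) `^ p.
    rewrite -powRrM powRM ?powR_ge0 ?(ltW d2) // -powRrM; congr (_ * _ `^ _).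
    by rewrite /d; field; rewrite !gt_eqF.
  apply: ge0_ler_powR; rewrite ?nnegrE ?powR_ge0 ?(ltW p0) //.
  apply: le_trans (norm_const_dim_le u (ltnW n1)) _.
  rewrite -powR_mulrn //; apply: ge0_ler_powR; rewrite ?nnegrE ?ler0n //.
    by rewrite mulr_ge0 ?powR_ge0 ?(ltW d2).
  exact: ln_le_powR.
have Mn : M < n%:R.
  by apply: lt_le_trans (truncnS_gt M) _; rewrite ler_nat.
have AK : `|A| * K < n%:R `^ (e / 2).
  have Me : M `^ (e / 2) = `|A| * K + 1.
    rewrite /M -powRrM (_ : 2 / e * (e / 2) = 1); last by field; lra.
    by rewrite powRr1 // addr_ge0 // mulr_ge0 // ltW.
  apply: (@lt_trans _ _ (`|A| * K + 1)); first by rewrite ltrDl.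
  rewrite -Me; apply: gt0_ltr_powR; rewrite ?nnegrE ?powR_ge0 ?divr_gt0 //.
have -> : n%:R `^ e = n%:R `^ (e / 2) * n%:R `^ (e / 2).
  by rewrite -powRD_gt0 //; congr (_ `^ _); field.
have h0 : 0 < n%:R `^ (e / 2) by exact: powR_gt0.
apply: (@le_lt_trans _ _ (`|A| * K * n%:R `^ (e / 2))).
  rewrite -mulrA (le_trans (ler_wpM2r (powR_ge0 _ _) (ler_norm A))) //.
  exact: ler_wpM2l.
by rewrite ltr_pM2r.
Qed.

End NormConst.

(** * Link probabilities, mean distance and reciprocity *)

Section Payoff.
Context {R : realType} (k n g : nat).
Hypotheses (k0 : (0 < k)%N) (n1 : (1 < n)%N) (g1 : (1 < g)%N).
Implicit Types (u v : node k n) (r : R) (s : node k n -> R).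

Let norm_const_gt0 u r : 0 < norm_const u r.
Proof. exact: lt_le_trans ltr01 (norm_const_ge1 u r k0 n1). Qed.

Lemma link_prob_ge0 u v r : 0 <= link_prob u v r.
Proof. by rewrite divr_ge0 ?powR_ge0 // ltW. Qed.

Lemma link_prob_sym u v r : link_prob u v r = link_prob v u r.
Proof. by rewrite /link_prob torus_dist_sym (norm_const_eq u v). Qed.

Lemma link_prob_sum1 u r : \sum_(v | v != u) link_prob u v r = 1.
Proof. by rewrite -mulr_suml -/(norm_const u r) divff ?gt_eqF. Qed.

Lemma link_prob_le1 u v r : v != u -> link_prob u v r <= 1.
Proof.
move=> vu; rewrite -(link_prob_sum1 u r) (bigD1 v) //= lerDl.
by apply: sumr_ge0 => w _; exact: link_prob_ge0.
Qed.

Lemma reciprocity_ge0 u s : 0 <= reciprocity u s.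
Proof. by apply: sumr_ge0 => v _; rewrite mulr_ge0 ?link_prob_ge0. Qed.

Lemma reciprocity_le1 u s : reciprocity u s <= 1.
Proof.
rewrite -(link_prob_sum1 u (s u)); apply: ler_sum => v vu.
by rewrite ler_piMr ?link_prob_ge0 // link_prob_le1 // eq_sym.
Qed.

Lemma mean_dist_ge0 u r : 0 <= mean_dist u r.
Proof. by apply: sumr_ge0 => v _; rewrite mulr_ge0 ?link_prob_ge0. Qed.

Lemma mean_dist_le u r : mean_dist u r <= k%:R * n%:R.
Proof.
have -> : k%:R * n%:R = \sum_(v | v != u) link_prob u v r * (k%:R * n%:R).
  by rewrite -mulr_suml link_prob_sum1 mul1r.
apply: ler_sum => v _.
by rewrite ler_wpM2l ?link_prob_ge0 // -natrM ler_nat torus_dist_le.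
Qed.

Lemma mean_distE u r : mean_dist u r = norm_const u (r - 1) / norm_const u r.
Proof.
rewrite /mean_dist /link_prob mulr_suml; apply: eq_bigr => v vu.
have d0 : 0 < (torus_dist u v)%:R :> R by rewrite ltr0n torus_dist_gt0.
by rewrite mulrAC opprB addrC powRD_gt0 // powRr1 // ltW.
Qed.

(** As d >= 1, d^(1-r) <= d^(-k) d^(1-1/g), and the last factor is at most k n^(1-1/g); the
    denominator is at least 1. *)
Lemma mean_dist_steep_le u r : k%:R + g%:R^-1 <= r ->
  mean_dist u r <= k%:R * n%:R / n%:R `^ g%:R^-1 * norm_const u k%:R.
Proof.
move=> kr; have n0 : 0 < n%:R :> R by rewrite ltr0n ltnW.
have kR : 1 <= k%:R :> R by rewrite ler1n.
have gi : g%:R^-1 <= 1 :> R by rewrite invf_le1 ?ler1n ?ltr0n ltnW // ltnW.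
have gi0 : 0 <= g%:R^-1 :> R by rewrite invr_ge0.
apply: (@le_trans _ _ (norm_const u (r - 1))).
  by rewrite mean_distE ler_pdivrMr // ler_peMr ?norm_const_ge1 // ltW.
rewrite mulrC mulr_suml; apply: ler_sum => v vu.
have d1 : 1 <= (torus_dist u v)%:R :> R by rewrite ler1n torus_dist_gt0.
have d0 : 0 < (torus_dist u v)%:R :> R by lra.
apply: (@le_trans _ _ ((torus_dist u v)%:R `^ (- k%:R + (1 - g%:R^-1)))).
  by rewrite ler_powR //; lra.
rewrite powRD_gt0 // ler_wpM2l ?powR_ge0 //.
apply: (@le_trans _ _ ((k%:R * n%:R) `^ (1 - g%:R^-1))).
  apply: ge0_ler_powR; rewrite ?nnegrE ?mulr_ge0 ?ler0n //; first by lra.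
  by rewrite -natrM ler_nat torus_dist_le.
rewrite powRM ?ler0n // [n%:R `^ _]powRD_gt0 // powRN powRr1 ?ler0n // mulrA.
rewrite ler_wpM2r ?invr_ge0 ?powR_ge0 // ler_wpM2r ?ler0n //.
by rewrite ler1_powR //; lra.
Qed.

Lemma reciprocity_shallow_le u s : 0 <= s u <= k%:R - g%:R^-1 ->
  (forall v, exists2 j : nat, (j <= k * g)%N & s v = j%:R * g%:R^-1) ->
  n%:R `^ g%:R^-1 * reciprocity u s <= 2 * k%:R `^ k%:R * (k * g).+1%:R.
Proof.
move=> /andP[su0 suk] hs.
have gi0 : 0 <= g%:R^-1 :> R by rewrite invr_ge0.
have n1R : 1 <= n%:R :> R by rewrite ler1n ltnW.
have B0 : 0 <= 2 * k%:R `^ k%:R :> R by rewrite mulr_ge0 ?powR_ge0.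
have prob_le v : v != u -> n%:R `^ g%:R^-1 * link_prob u v (s u) <= 2 * k%:R `^ k%:R.
  move=> vu; rewrite mulrA ler_pdivrMr //.
  (* The constant at [s u] is at least n^(1/g) / (2 k^k) because k - [s u] >= 1/g; the numerator
     d^(-[s u]) is at most 1. *)
  have /(norm_const_ge u k0 n1) : 0 <= s u <= k%:R by rewrite su0; lra.
  apply: le_trans; rewrite -[leRHS]mulr1; apply: ler_pM; rewrite ?powR_ge0 //.
    by rewrite ler_powR //; lra.
  have d1 : 1 <= (torus_dist u v)%:R :> R by rewrite ler1n torus_dist_gt0.
  by rewrite -[leRHS](powRr0 (torus_dist u v)%:R) ler_powR //; lra.
have in_le : \sum_(v | v != u) link_prob v u (s v) <= (k * g).+1%:R.
  (* Summing over all admissible exponents covers the one used by [v]; at a fixed exponent, symmetry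
     turns incoming links into outgoing ones, of total 1. *)
  apply: (@le_trans _ _ (\sum_(v | v != u) \sum_(j < (k * g).+1)
      link_prob u v (j%:R * g%:R^-1))).
    apply: ler_sum => v _; have [j jk ->] := hs v.
    rewrite (bigD1 (Ordinal (jk : (j < (k * g).+1)%N))) //= link_prob_sym lerDl.
    by apply: sumr_ge0 => i _; exact: link_prob_ge0.
  rewrite exchange_big /=; under eq_bigr do rewrite link_prob_sum1.
  by rewrite sumr_const card_ord.
apply: le_trans (ler_wpM2l B0 in_le); rewrite !mulr_sumr.
apply: ler_sum => v vu; rewrite mulrA ler_wpM2r ?link_prob_ge0 //.
exact: prob_le.
Qed.

(** The mean distance is the quotient of the constants at k - 1 and k; [norm_const_ge] bounds the
    numerator by n / (2 k^k) from below. *)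
Lemma mean_dist_dim_ge u :
  n%:R / (2 * k%:R `^ k%:R * norm_const u k%:R) <= mean_dist u k%:R :> R.
Proof.
have kR : 1 <= k%:R :> R by rewrite ler1n.
have B0 : 0 < 2 * k%:R `^ k%:R :> R by rewrite mulr_gt0 // powR_gt0; lra.
rewrite mean_distE invfM mulrA ler_wpM2r ?invr_ge0 ?(ltW (norm_const_gt0 _ _)) //.
rewrite ler_pdivrMr // mulrC.
have k1 : 0 <= (k%:R - 1 : R) <= k%:R by apply/andP; split; lra.
have := norm_const_ge u k0 n1 k1.
by rewrite opprB addrC subrK powRr1 ?ler0n.
Qed.

Lemma reciprocity_const_ge u r :
  (norm_const u r ^+ 2)^-1 <= reciprocity u (fun=> r).
Proof.
have [v vu d1] := torus_neighbor u k0 n1.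
rewrite /reciprocity (bigD1 v) //= -[link_prob v u r]link_prob_sym.
rewrite /link_prob d1 powR1 mul1r -invfM -expr2 lerDl.
by apply: sumr_ge0 => w _; rewrite mulr_ge0 ?link_prob_ge0.
Qed.

End Payoff.

(** * Numerical comparison of the payoff bounds *)

Section Comparison.
Context {R : realType}.
Implicit Types K B N c x a : R.

(** To be used with [N] = n and [x] = n^(1/g). The quotient of the two bases is K B c^2 / x <= 1, so
    its power is largest at the smallest exponent [amin]. *)
Lemma steep_comparison K B N c x a amin : 0 < amin <= a ->
  0 < K -> 0 < B -> 0 < N -> 1 <= c -> 0 < x ->
  K * B * c ^+ 2 <= x ->
  (K * B) `^ amin * c `^ (2 * amin + 2) < x `^ amin ->
  (K * N / x * c) `^ a < (N / (B * c)) `^ a / c ^+ 2.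
Proof.
move=> /andP[am0 aa] K0 B0 N0 c1 x0 cx hx.
have c0 : 0 < c by lra.
have Y0 : 0 < N / (B * c) by rewrite divr_gt0 // mulr_gt0.
have X0 : 0 < K * B * c ^+ 2 / x by rewrite !(divr_gt0, mulr_gt0) // exprn_gt0.
have -> : K * N / x * c = (K * B * c ^+ 2 / x) * (N / (B * c)).
  by field; rewrite !gt_eqF.
rewrite powRM ?(ltW X0) ?(ltW Y0) // mulrC ltr_pM2l ?powR_gt0 //.
have X1 : K * B * c ^+ 2 / x <= 1 by rewrite ler_pdivrMr // mul1r.
apply: (@le_lt_trans _ _ ((K * B * c ^+ 2 / x) `^ amin)).
  by apply: ger_powR => //; rewrite X0.
rewrite -[ltRHS]mul1r ltr_pdivlMr ?exprn_gt0 //.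
have KB0 : 0 <= K * B by rewrite mulr_ge0 // ltW.
have c20 : 0 <= c ^+ 2 by rewrite exprn_ge0 // ltW.
have xi0 : 0 <= x^-1 by rewrite invr_ge0 ltW.
rewrite powRM ?(mulr_ge0 KB0) // powRM // -(powR_mulrn 2 (ltW c0)) -powRrM.
have -> : x^-1 `^ amin = (x `^ amin)^-1.
  by rewrite -(powR_inv1 (ltW x0)) -powRrM mulN1r powRN.
by rewrite mulrAC -[_ * c `^ _ * c `^ _]mulrA -powRD_gt0 // ltr_pdivrMr ?mul1r // powR_gt0.
Qed.

(** Here the quotient of the bases is K B c >= 1, so its power is largest at the upper bound [b];
    [m] will be the number of admissible exponents. *)
Lemma shallow_comparison K B N c x m a b : 0 <= a <= b ->
  1 <= K -> 1 <= B -> 0 < N -> 1 <= c -> 0 < x -> 0 <= m ->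
  (K * B) `^ b * B * m * c `^ (b + 2) < x ->
  (K * N) `^ a * (B * m / x) < (N / (B * c)) `^ a / c ^+ 2.
Proof.
move=> /andP[a0 ab] K1 B1 N0 c1 x0 m0 hx.
have c0 : 0 < c by lra.
have Y0 : 0 < N / (B * c) by rewrite divr_gt0 // mulr_gt0; lra.
have KB1 : 1 <= K * B by rewrite -[leLHS]mulr1 ler_pM; lra.
have KBc1 : 1 <= K * B * c by rewrite -[leLHS]mulr1 ler_pM; lra.
have -> : K * N = (K * B * c) * (N / (B * c)) by field; rewrite !gt_eqF //; lra.
rewrite powRM ?(ltW Y0) //; last by lra.
rewrite mulrAC [ltLHS]mulrC ltr_pM2l ?powR_gt0 //.
rewrite -[ltRHS]mul1r ltr_pdivlMr ?exprn_gt0 //.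
have -> : (K * B * c) `^ a * (B * m / x) * c ^+ 2
  = (K * B * c) `^ a * (B * m) * c ^+ 2 / x by ring.
rewrite ltr_pdivrMr // mul1r.
apply: le_lt_trans hx; rewrite powRD_gt0 // powR_mulrn ?(ltW c0) //.
have -> : (K * B) `^ b * B * m * (c `^ b * c ^+ 2) = (K * B * c) `^ b * (B * m) * c ^+ 2.
  rewrite [(K * B * c) `^ b]powRM; [ring|lra..].
rewrite ler_wpM2r ?exprn_ge0 ?(ltW c0) // ler_wpM2r ?ler_powR //.
by rewrite mulr_ge0 //; lra.
Qed.

End Comparison.

(** * Strict payoff loss for exponents above or below k *)

Section Deviations.
Context {R : realType} (k n g : nat).
Hypotheses (k0 : (0 < k)%N) (n1 : (1 < n)%N) (g1 : (1 < g)%N).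
Variable alpha : node k n -> R.
Implicit Types (u v : node k n) (s : node k n -> R).

Let B : R := 2 * k%:R `^ k%:R.

Lemma payoff_ext u s s' : s =1 s' -> payoff alpha u s = payoff alpha u s'.
Proof.
move=> ss'; rewrite /payoff /reciprocity ss'; congr (_ * _).
by apply: eq_bigr => v _; rewrite ss'.
Qed.

Lemma payoff_dim_ge u : 0 <= alpha u ->
  (n%:R / (B * norm_const u k%:R)) `^ alpha u / norm_const u k%:R ^+ 2
  <= payoff alpha u (fun=> k%:R).
Proof.
move=> a0; have c0 := lt_le_trans ltr01 (norm_const_ge1 u (k%:R : R) k0 n1).
have B0 : 0 <= B by rewrite mulr_ge0 ?powR_ge0.
apply: ler_pM; rewrite ?powR_ge0 ?invr_ge0 ?exprn_ge0 ?(ltW c0) //.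
  apply: ge0_ler_powR; rewrite ?nnegrE ?mean_dist_ge0 ?mean_dist_dim_ge //.
  by rewrite divr_ge0 // mulr_ge0 // ltW.
exact: reciprocity_const_ge.
Qed.

Lemma payoff_steep_lt u s amin : 0 < amin <= alpha u ->
  k%:R * B * norm_const u k%:R ^+ 2 <= n%:R `^ g%:R^-1 ->
  (k%:R * B) `^ amin * norm_const u k%:R `^ (2 * amin + 2)
    < (n%:R `^ g%:R^-1) `^ amin ->
  k%:R + g%:R^-1 <= s u -> payoff alpha u s < payoff alpha u (fun=> k%:R).
Proof.
move=> am h1 h2 su; have a0 : 0 <= alpha u by case/andP: am; lra.
have kR : 0 < k%:R :> R by rewrite ltr0n.
have nR : 0 < n%:R :> R by rewrite ltr0n ltnW.
have c1 := norm_const_ge1 u (k%:R : R) k0 n1.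
have B0 : 0 < B by rewrite mulr_gt0 ?powR_gt0.
apply: lt_le_trans (payoff_dim_ge a0).
apply: le_lt_trans (steep_comparison am kR B0 nR c1 (powR_gt0 _ nR) h1 h2).
rewrite /payoff -[leRHS]mulr1.
apply: ler_pM; rewrite ?powR_ge0 ?reciprocity_ge0 ?reciprocity_le1 //.
apply: ge0_ler_powR; rewrite ?nnegrE ?mean_dist_ge0 ?mean_dist_steep_le //.
by rewrite !mulr_ge0 ?invr_ge0 ?powR_ge0 //; lra.
Qed.

Lemma payoff_shallow_lt u s b : 0 <= alpha u <= b ->
  (k%:R * B) `^ b * B * (k * g).+1%:R * norm_const u k%:R `^ (b + 2)
    < n%:R `^ g%:R^-1 ->
  0 <= s u <= k%:R - g%:R^-1 ->
  (forall v, exists2 j : nat, (j <= k * g)%N & s v = j%:R * g%:R^-1) ->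
  payoff alpha u s < payoff alpha u (fun=> k%:R).
Proof.
move=> ab h su hs; have a0 : 0 <= alpha u by case/andP: ab.
have k1 : 1 <= k%:R :> R by rewrite ler1n.
have nR : 0 < n%:R :> R by rewrite ltr0n ltnW.
have c1 := norm_const_ge1 u (k%:R : R) k0 n1.
have B1 : 1 <= B.
  have : 1 <= k%:R `^ k%:R :> R by have := ler_powR k1 (ler0n R k); rewrite powRr0.
  by rewrite /B; lra.
have x0 : 0 < n%:R `^ g%:R^-1 :> R by exact: powR_gt0.
apply: lt_le_trans (payoff_dim_ge a0).
apply: le_lt_trans (shallow_comparison ab k1 B1 nR c1 x0 (ler0n _ _) h).
apply: ler_pM; rewrite ?powR_ge0 ?reciprocity_ge0 //.
  apply: ge0_ler_powR; rewrite ?nnegrE ?mean_dist_ge0 ?mean_dist_le //.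
  by rewrite mulr_ge0 ?ler0n.
by rewrite ler_pdivlMr // mulrC reciprocity_shallow_le.
Qed.

End Deviations.

End CoalitionDeviations.

(* The node set varies with n, so "n0 depends only on the constants alpha_u" is
   read as: n0 depends only on a range [amin, amax], with amin > 0, containing
   all the exponents, which are otherwise arbitrary and may differ from node to
   node.  Without such a range the claim fails (exponents could grow, or tend
   to 0, with n). *)
Theorem theorem3p3 (R : realType) (k g : nat) (amin amax : R)
    (hk : (1 <= k)%N) (hg : (2 <= g)%N) (hamin : 0 < amin) :
  exists n0 : nat, forall n : nat, (2 <= n)%N -> (n0 <= n)%N ->
    forall alpha : node k n -> R,
      (forall u : node k n, amin <= alpha u <= amax) ->
      strong_nash (g%:R^-1) alpha (fun _ : node k n => k%:R).
Proof.
have g0 : 0 < g%:R :> R by rewrite ltr0n ltnW.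
have gi0 : 0 < g%:R^-1 :> R by rewrite invr_gt0.
pose B : R := 2 * k%:R `^ k%:R.
(* [H1] and [H2] supply the size conditions for exponents above k, [H3] the one for exponents below
   k. *)
have [n1 H1] := norm_const_growth (k%:R * B) hk (ltr0n R 2) gi0.
have [n2 H2] : exists n0 : nat, forall n : nat, (1 < n)%N -> (n0 <= n)%N ->
    forall u : node k n, (k%:R * B) `^ amin * norm_const u k%:R `^ (2 * amin + 2)
      < n%:R `^ (g%:R^-1 * amin).
  by apply: norm_const_growth; rewrite ?mulr_gt0 //; lra.
(* No sign of [amax] is known here; its absolute value still bounds every [alpha u] and keeps the
   power positive. *)
have [n3 H3] : exists n0 : nat, forall n : nat, (1 < n)%N -> (n0 <= n)%N ->
    forall u : node k n, (k%:R * B) `^ `|amax| * B * (k * g).+1%:R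
      * norm_const u k%:R `^ (`|amax| + 2) < n%:R `^ g%:R^-1.
  by apply: norm_const_growth; rewrite // ltr_wpDl.
exists (maxn n1 (maxn n2 n3)) => n hn; rewrite !geq_max => /and3P[hn1 hn2 hn3].
move=> alpha halpha.
have kE : k%:R = (k * g)%:R * g%:R^-1 :> R by rewrite natrM mulfK // gt_eqF.
split=> [u|C _ _ [sC [sC_strat weak [u uC strict]]]]; first by exists (k * g)%N.
set s := deviate C sC _ in weak strict.
have s_out v : v \notin C -> s v = k%:R by move=> vC; rewrite /s /deviate (negbTE vC).
have s_in v : v \in C -> s v = sC v by move=> vC; rewrite /s /deviate vC.
(* This comes first: the bound for a small exponent at one node requires all nodes to use exponents
   at most k. *)
have not_steep v : exists2 j : nat, (j <= k * g)%N & s v = j%:R * g%:R^-1.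
  have [vC|vC] := boolP (v \in C); last by exists (k * g)%N => //; rewrite s_out.
  have [j jE] := sC_strat v vC; exists j; last by rewrite s_in.
  rewrite leqNgt; apply/negP => kgj.
  have := weak v vC; rewrite leNgt => /negP; apply.
  apply: (@payoff_steep_lt R k n g hk hn hg alpha v s amin).
  - by rewrite hamin; have /andP[] := halpha v.
  - rewrite -powR_mulrn; first exact/ltW/H1.
    exact: le_trans ler01 (norm_const_ge1 v _ hk hn).
  - by rewrite -powRrM H2.
  rewrite s_in // jE kE -[X in _ + X]mul1r -mulrDl ler_wpM2r ?(ltW gi0) //.
  by rewrite natr1 ler_nat.
have s_dim v : s v = k%:R.
  have [vC|] := boolP (v \in C); last exact: s_out.
  have [j jk jE] := not_steep v; rewrite jE kE.
  have [->//|jk'] := eqVneq j (k * g)%N.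
  have := weak v vC; rewrite leNgt => /negP; case.
  apply: (@payoff_shallow_lt R k n g hk hn alpha v s `|amax|) => //.
  - have /andP[am aM] := halpha v; apply/andP; split; first by lra.
    exact: le_trans aM (ler_norm _).
  - exact: H3.
  rewrite jE mulr_ge0 ?(ltW gi0) //= kE -[X in _ - X]mul1r -mulrBl.
  rewrite ler_wpM2r ?(ltW gi0) // lerBrDr natr1 ler_nat.
  by rewrite ltn_neqAle jk' jk.
(* The deviation agrees with the original profile everywhere, so no payoff strictly increases. *)
by move: strict; rewrite (payoff_ext alpha u s_dim) ltxx.
Qed.
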